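(* Consider the programs $(\mathcal P_n)$ and $(\mathcal D_n)$ defined in the context, with optimal values $J_n$ and $\widetilde J_n$. (1) If $(\mathcal P_n)$ is feasible, then the duality gap between $(\mathcal P_n)$ and $(\mathcal D_n)$ is zero: $J_n=\widetilde J_n$. (2) Suppose in addition that there is a constant $\gamma>0$ with $\|\mathcal A_n^* y\|_{\mathfrak R^*}\ge \gamma\|y\|_*$ for every $y\in\mathbb K^*$, and that $\theta_{\mathcal P}$ is large enough so that $\gamma\theta_{\mathcal P}>\|b\|$. Then for any optimizer $y_n^\star$ of $(\mathcal D_n)$ and any lower bound $J_n^{\rm LB}\le J_n$, $$\|y_n^\star\|_*\le \theta_{\mathcal D}:=\frac{\theta_{\mathcal P}\|\mathbf c\|_{\mathfrak R^*}-J_n^{\rm LB}}{\gamma\theta_{\mathcal P}-\|b\|}\le \frac{2\theta_{\mathcal P}\|\mathbf c\|_{\mathfrak R^*}}{\gamma\theta_{\mathcal P}-\|b\|}.$$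
   Context: Dual pairs: $\mathbb X,\mathbb C$ are real vector spaces with a bilinear form $\langle\cdot,\cdot\rangle$ on $\mathbb X\times\mathbb C$ separating points on both sides; $\mathbb X$ carries a norm $\|\cdot\|$ (not necessarily complete), which induces the dual norm $\|c\|_*:=\sup_{\|x\|\le1}\langle x,c\rangle$ on $\mathbb C$. $(\mathbb B,\mathbb Y,\|\cdot\|)$ is another such dual pair (same notation). $\mathcal A:\mathbb X\to\mathbb B$ is linear and continuous with respect to the weak topologies (the weakest topologies for which the topological duals of $\mathbb X$, $\mathbb B$ are $\mathbb C$, $\mathbb Y$). $\mathbb K\subset\mathbb B$ is a closed convex cone (same topology), with dual cone $\mathbb K^*:=\{y\in\mathbb Y:\langle z,y\rangle\ge0\ \forall z\in\mathbb K\}$. $c\in\mathbb C$, $b\in\mathbb B$ are fixed; $z\succeq_{\mathbb K}b$ means $z-b\in\mathbb K$. Let $x_1,\dots,x_n\in\mathbb X$ be linearly independent with $\|x_i\|=1$, let $\|\cdot\|_{\mathfrak R}$ be a norm on $\mathbb R^n$ with dual norm $\|\cdot\|_{\mathfrak R^*}$, and $\theta_{\mathcal P}>0$. Write $\alpha\cdot\beta$ for the standard inner product. Define $\mathcal A_n\alpha:=\sum_{i=1}^n\alpha_i\mathcal Ax_i\in\mathbb B$, $\mathcal A_n^*y:=[\langle\mathcal Ax_1,y\rangle,\dots,\langle\mathcal Ax_n,y\rangle]\in\mathbb R^n$, $\mathbf c:=[\langle x_1,c\rangle,\dots,\langle x_n,c\rangle]$. $(\mathcal P_n)$: $J_n:=\inf\{\alpha\cdot\mathbf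 c:\ \alpha\in\mathbb R^n,\ \mathcal A_n\alpha\succeq_{\mathbb K}b,\ \|\alpha\|_{\mathfrak R}\le\theta_{\mathcal P}\}$. $(\mathcal D_n)$: $\widetilde J_n:=\sup\{\langle b,y\rangle-\theta_{\mathcal P}\|\mathcal A_n^*y-\mathbf c\|_{\mathfrak R^*}:\ y\in\mathbb K^*\}$.
   Formalization: The last inequality θ_D ≤ 2θ_P‖c‖/(γθ_P−‖b‖) fails for very small lower bounds J_n^LB, so it is stated only when J_n^LB ≥ −θ_P‖c‖ (an equivalent condition); the bound of ‖y_n*‖_* by the right-most quantity is proved unconditionally. *)

(* Defs.v *)
From HB Require Import structures.
From mathcomp Require Import all_boot all_order all_algebra.
From mathcomp Require Import all_classical all_reals all_analysis.

Set Implicit Arguments.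
Unset Strict Implicit.
Unset Printing Implicit Defensive.

Import Order.TTheory GRing.Theory Num.Theory.
Import numFieldNormedType.Exports.

Local Open Scope classical_set_scope.
Local Open Scope ring_scope.

Definition separating (R : realType) (X C : lmodType R)
    (f : {bilinear X -> C -> R | *%R & *%R}) : Prop :=
  (forall x, (forall c, f x c = 0) -> x = 0) /\
  (forall c, (forall x, f x c = 0) -> c = 0).

(* The weak topology sigma(X, C): the coarsest topology on X for which every
   f ^~ c, c : C, is continuous. It is carried by a copy of X, so that it does
   not compete with the norm topology of X. *)
Definition weak_of_pair (R : realType) (X C : lmodType R)
    (f : {bilinear X -> C -> R | *%R & *%R}) : Type :=
  sup_topology (fun c : C =>
    Topological.on (initial_topology (fun x : X => f x c : R))).

HB.instance Definition _ (R : realType) (X C : lmodType R)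
    (f : {bilinear X -> C -> R | *%R & *%R}) :=
  Topological.on (weak_of_pair f).

(* Extended-real valued: in a bare dual pair nothing forces every c : C to be
   bounded on the unit ball of X. *)
Definition dual_norm (R : realType) (X : normedModType R) (C : lmodType R)
    (f : {bilinear X -> C -> R | *%R & *%R}) (c : C) : \bar R :=
  ereal_sup [set (f x c)%:E | x in [set x : X | `|x| <= 1]].

Definition cone (R : realType) (B : lmodType R) (K : set B) : Prop :=
  forall (t : R) (z : B), 0 <= t -> K z -> K (t *: z).

Definition dual_cone (R : realType) (B Y : lmodType R)
    (g : {bilinear B -> Y -> R | *%R & *%R}) (K : set B) : set Y :=
  [set y | forall z, K z -> 0 <= g z y].

Definition lin_indep (R : realType) (X : lmodType R) (n : nat)
    (x : 'I_n -> X) : Prop :=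
  forall a : 'rV[R]_n, \sum_(i < n) a 0 i *: x i = 0 -> a = 0.

Definition dot (R : realType) (n : nat) (a b : 'rV[R]_n) : R :=
  \sum_(i < n) a 0 i * b 0 i.

Definition is_norm (R : realType) (n : nat) (N : 'rV[R]_n -> R) : Prop :=
  [/\ forall a b, N (a + b) <= N a + N b,
      forall (t : R) a, N (t *: a) = `|t| * N a
    & forall a, N a = 0 -> a = 0].

(* When N is a norm the set is nonempty and bounded above, as all norms on
   R^n are equivalent, so the default value of [sup] plays no role. *)
Definition dual_norm_rV (R : realType) (n : nat) (N : 'rV[R]_n -> R)
    (b : 'rV[R]_n) : R :=
  sup [set dot a b | a in [set a | N a <= 1]].

Section Programs.
Variables (R : realType) (X : normedModType R) (C : lmodType R).
Variable f : {bilinear X -> C -> R | *%R & *%R}.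
Variables (B : normedModType R) (Y : lmodType R).
Variable g : {bilinear B -> Y -> R | *%R & *%R}.
Variables (A : {linear X -> B}) (K : set B) (c : C) (b : B).
Variables (n : nat) (x : 'I_n -> X) (N : 'rV[R]_n -> R) (thetaP : R).

Definition An (a : 'rV[R]_n) : B := \sum_(i < n) a 0 i *: A (x i).

Definition An_adj (y : Y) : 'rV[R]_n := \row_(i < n) g (A (x i)) y.

Definition cvec : 'rV[R]_n := \row_(i < n) f (x i) c.

Definition primal_feasible : set 'rV[R]_n :=
  [set a | K (An a - b) /\ N a <= thetaP].

Definition primal_value : \bar R :=
  ereal_inf [set (dot a cvec)%:E | a in primal_feasible].

Definition dual_objective (y : Y) : R :=
  g b y - thetaP * dual_norm_rV N (An_adj y - cvec).

Definition dual_value : \bar R :=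
  ereal_sup [set (dual_objective y)%:E | y in dual_cone g K].

Definition dual_optimizer (y : Y) : Prop :=
  dual_cone g K y /\ (dual_objective y)%:E = dual_value.

(* Decreasing in JLB: it is at most
   2 * thetaP * dual_norm_rV N cvec / (gamma * thetaP - `|b|) exactly when JLB
   is no worse than the trivial lower bound - thetaP * dual_norm_rV N cvec of
   primal_value. *)
Definition thetaD (gamma JLB : R) : R :=
  (thetaP * dual_norm_rV N cvec - JLB) / (gamma * thetaP - `|b|).

End Programs.

(* Main.v *)
(** Weak duality is the pairing of a feasible point with an element of the dual
    cone. For the converse fix [r] below the primal value and consider the
    convex set of all pairs [(An a - b - k, dot a cvec - r + t)] with
    [N a <= thetaP],
    [K k] and [0 <= t]. As the norm ball of R^n is compact and [K] is weakly
    closed, some weak neighbourhood of the origin, given by finitely many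
    functionals of [Y], misses this set; so its image in a finite-dimensional
    space can be strictly separated from the origin. Feasibility makes the
    coefficient of the last coordinate positive, and normalising it to 1 turns
    the separating functional into a dual point of objective at least [r].

    The bound on dual optimizers follows from the chain
    [JLB <= g b y - thetaP * |An_adj y - cvec|
         <= |b| |y| - thetaP * (gamma |y| - |cvec|)]. *)

Require Import Defs.
From HB Require Import structures.
From mathcomp Require Import all_boot all_order all_algebra.
From mathcomp Require Import all_classical all_reals all_analysis.
From mathcomp Require Import lra ring.

Import Order.TTheory GRing.Theory Num.Theory.
Import numFieldNormedType.Exports.

Local Open Scope classical_set_scope.
Local Open Scope ring_scope.

Lemma closed_fun_le {R : realType} {T : topologicalType} (h : T -> R) (t : R) :
  continuous h -> closed [set x | h x <= t].
Proof.
move=> ch; have := @preimage_closed T R h [set s | s <= t].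
by apply; [move=> x _; exact: ch|exact: closed_le].
Qed.

(** * Inner product on row vectors and separation of a convex set from the origin *)

Section RowVectors.
Context {R : realType} {n : nat}.
Implicit Types (a b u v : 'rV[R]_n) (t : R).

Lemma dotC a b : dot a b = dot b a.
Proof. by apply: eq_bigr => i _; rewrite mulrC. Qed.

Lemma dotDl a b u : dot (a + b) u = dot a u + dot b u.
Proof. by rewrite -big_split; apply: eq_bigr => i _; rewrite mxE mulrDl. Qed.

Lemma dotZl t a u : dot (t *: a) u = t * dot a u.
Proof. by rewrite big_distrr; apply: eq_bigr => i _; rewrite /= mxE mulrA. Qed.

Lemma dotNl a u : dot (- a) u = - dot a u.
Proof. by rewrite -scaleN1r dotZl mulN1r. Qed.

Lemma dotDr a u v : dot a (u + v) = dot a u + dot a v.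
Proof. by rewrite !(dotC a) dotDl. Qed.

Lemma dotBr a u v : dot a (u - v) = dot a u - dot a v.
Proof. by rewrite dotDr (dotC a (- v)) dotNl (dotC v). Qed.

Lemma dotZr t a u : dot a (t *: u) = t * dot a u.
Proof. by rewrite !(dotC a) dotZl. Qed.

Lemma sqr_coord_le_dot a i : a 0 i ^+ 2 <= dot a a.
Proof.
rewrite /dot (bigD1 i)//= -expr2 lerDl sumr_ge0// => j _.
by rewrite -expr2 sqr_ge0.
Qed.

Lemma dot_eq0 a : dot a a <= 0 -> a = 0.
Proof.
move=> aa0; apply/rowP => i; rewrite mxE; apply/eqP.
by rewrite -sqrf_eq0 eq_le sqr_ge0 andbT (le_trans (sqr_coord_le_dot a i)).
Qed.

Lemma coord_le_norm a i : `|a 0 i| <= `|a|.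
Proof. by rewrite [leRHS]mx_normrE; apply/bigmax_geP; right; exists (0, i). Qed.

Lemma norm_le_coord a t : 0 <= t -> (forall i, `|a 0 i| <= t) -> `|a| <= t.
Proof.
move=> t0 h; rewrite [leLHS]mx_normrE; apply/bigmax_leP; split => //.
by move=> -[j i] _ /=; rewrite (ord1 j).
Qed.

Lemma cvg_dot {T : Type} {F : set_system T} {FF : Filter F}
    (u_ v_ : T -> 'rV[R]_n) u v :
  u_ t @[t --> F] --> u -> v_ t @[t --> F] --> v ->
  dot (u_ t) (v_ t) @[t --> F] --> dot u v.
Proof.
move=> cu cv; apply: cvg_big => [|i _]; first exact: add_continuous.
have coord (w_ : T -> 'rV[R]_n) (w : 'rV[R]_n) :
    w_ t @[t --> F] --> w -> w_ t 0 i @[t --> F] --> w 0 i.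
  move=> cw; apply: (@cvg_comp _ _ _ w_ (fun M : 'rV[R]_n => M 0 i)) cw _.
  exact: coord_continuous.
by apply: cvgM; exact: coord.
Qed.

Lemma bounded_set_normle (A : set 'rV[R]_n) (t : R) :
  (forall a, A a -> `|a| <= t) -> bounded_set A.
Proof.
move=> At; exists t; split; first exact: num_real.
by move=> s /ltW ts a /At /le_trans; apply.
Qed.

(* [l] is the point of [closure T] closest to the origin. *)
Lemma convex_separation_rV (T : set 'rV[R]_n) (e : R) :
  T !=set0 ->
  (forall p q t, 0 <= t <= 1 -> T p -> T q -> T ((1 - t) *: p + t *: q)) ->
  0 < e -> (forall p, T p -> e <= `|p|) ->
  exists l : 'rV[R]_n, exists2 d : R, 0 < d & forall p, T p -> d <= dot l p.
Proof.
move=> [p0 Tp0] Tcvx e0 Te.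
(* The cut by a sublevel set makes [A] compact; a minimiser on [A] is one on all of [closure T]. *)
pose A := closure T `&` [set p | dot p p <= dot p0 p0].
have sub_closure (D : set 'rV[R]_n) : closed D -> T `<=` D -> closure T `<=` D.
  by move=> cD TD; rewrite closureE => p; apply; split.
have cdot : continuous (fun p : 'rV[R]_n => dot p p).
  by move=> p; apply: (@cvg_dot _ (nbhs p) _ id id).
have cA : compact A.
  apply: bounded_closed_compact.
    apply: (@bounded_set_normle _ (1 + dot p0 p0)) => p [_ /= pp0].
    have D0 : 0 <= dot p0 p0 by apply: sumr_ge0 => i _; rewrite -expr2 sqr_ge0.
    apply: norm_le_coord => [|i]; first by lra.
    have := le_trans (sqr_coord_le_dot p i) pp0.
    by rewrite -real_normK ?num_real// => ?; nra.
  apply: closedI; first exact: closed_closure.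
  exact: closed_fun_le.
have [||l] := EVT_min_rV (f := fun p : 'rV[R]_n => dot p p) _ cA.
- by exists p0; split => //=; exact: subset_closure.
- exact: continuous_subspaceT.
rewrite inE => -[cl ll0] lmin.
have {}lmin p : closure T p -> dot l l <= dot p p.
  move=> cp; have [pp0|/ltW] := leP (dot p p) (dot p0 p0).
    by apply: lmin; rewrite inE.
  exact: le_trans.
(* The bound by [e] passes to the closure, so [l] is nonzero and [dot l l] can serve as [d]. *)
have el : e <= `|l|.
  apply: (sub_closure [set p | e <= `|p|]) cl => //.
  rewrite (_ : mkset _ = [set p | - `|p| <= - e]).
    apply: closed_fun_le => p.
    exact: (cvgN (@norm_continuous R 'rV[R]_n p)).
  by apply/seteqP; split => p /=; rewrite lerN2.
exists l, (dot l l) => [|q Tq].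
  rewrite ltNge; apply/negP => /dot_eq0 l0.
  by move: el; rewrite l0 normr0 leNgt e0.
have cvx t : 0 <= t <= 1 -> closure T ((1 - t) *: l + t *: q).
  move=> t01; pose phi := fun p : 'rV[R]_n => (1 - t) *: p + t *: q.
  apply: (sub_closure (phi @^-1` closure T)) cl => [|p Tp]; last first.
    by apply: subset_closure; exact: Tcvx.
  apply: (continuous_closedP phi).1; last exact: closed_closure.
  move=> p.
  exact: (cvgD (@scaler_continuous R 'rV[R]_n (1 - t) p) (cvg_cst (t *: q))).
rewrite leNgt; apply/negP => lq.
pose E := dot (q - l) (q - l).
pose s := dot l q - dot l l.
have E0 : 0 <= E by apply: sumr_ge0 => i _; rewrite -expr2 sqr_ge0.
have s0 : s < 0 by rewrite subr_lt0.
(* Moving from [l] towards [q] by [t] changes the squared length by [t * (2 * s + t * E)], which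
   minimality keeps nonnegative. *)
have quad t : 0 < t <= 1 -> 0 <= 2 * s + t * E.
  move=> /andP[t0 t1].
  have /lmin : closure T ((1 - t) *: l + t *: q) by apply: cvx; rewrite t1 ltW.
  rewrite -subr_ge0 => h; rewrite -(pmulr_rge0 _ t0); move: h.
  suff -> : dot ((1 - t) *: l + t *: q) ((1 - t) *: l + t *: q) - dot l l =
    t * (2 * s + t * E) by [].
  rewrite /E /s !(dotDl, dotZl, dotNl, dotBr, dotDr, dotZr) (dotC q l).
  by ring.
have h : 0 < E - s + 1 by lra.
(* This [t] satisfies [t * E <= - s], so that [2 * s + t * E <= s < 0]. *)
have /quad : 0 < - s / (E - s + 1) <= 1.
  by rewrite divr_gt0 ?oppr_gt0//= ler_pdivrMr// mul1r; lra.
apply/negP; rewrite -ltNge.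
have -> : - s / (E - s + 1) * E = - s * (E / (E - s + 1)) by ring.
have : E / (E - s + 1) <= 1 by rewrite ler_pdivrMr// mul1r; lra.
by move: (E / _) => k k1; nra.
Qed.

End RowVectors.

(** * Equivalence of norms on R^n and the dual norm *)

Section NormRowVectors.
Context {R : realType} {n : nat} {N : 'rV[R]_n -> R}.
Hypothesis N_norm : is_norm N.
Implicit Types (a b u v : 'rV[R]_n) (t : R).

Lemma is_norm0 : N 0 = 0.
Proof. by case: N_norm => _ NZ _; rewrite -(scale0r 0) NZ normr0 mul0r. Qed.

Lemma is_normN a : N (- a) = N a.
Proof. by case: N_norm => _ NZ _; rewrite -scaleN1r NZ normrN1 mul1r. Qed.

Lemma is_norm_ge0 a : 0 <= N a.
Proof.
case: N_norm => ND _ _; have := ND a (- a).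
rewrite subrr is_norm0 is_normN; lra.
Qed.

(** Expand [a] in the standard basis; [L] is the sum of the norms of the basis vectors. *)
Lemma is_norm_le : exists2 L : R, 0 <= L & forall a, N a <= L * `|a|.
Proof.
case: N_norm => ND NZ _.
exists (\sum_i N (delta_mx 0 i)) => [|a].
  by apply: sumr_ge0 => i _; exact: is_norm_ge0.
rewrite {1}(row_sum_delta a) big_distrl /=.
apply: (big_ind2 (fun x y => N x <= y)) => [|x s y t xs yt|i _].
  by rewrite is_norm0.
  exact: le_trans (ND _ _) (lerD xs yt).
by rewrite NZ mulrC ler_wpM2l ?is_norm_ge0// coord_le_norm.
Qed.

Lemma is_norm_continuous : continuous N.
Proof.
case: N_norm => ND NZ _; have [L L0 NL] := is_norm_le.
have lip a b : `|N a - N b| <= L * `|a - b|.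
  apply: le_trans (NL _); rewrite ler_norml.
  have := ND (a - b) b; have := ND (b - a) a; rewrite !subrK.
  by rewrite -(is_normN (b - a)) opprB => ? ?; apply/andP; split; lra.
move=> a; apply/(@cvgrPdist_le _ _ _ (nbhs a)) => e e0.
(* [L] itself may vanish, so the division is by [L + 1]. *)
have L1 : 0 < L + 1 by lra.
near=> b; apply: le_trans (lip _ _) _.
have : `|a - b| <= e / (L + 1).
  by near: b; apply: cvgr_dist_le; [exact: cvg_id|exact: divr_gt0].
rewrite ler_pdivlMr// => h; have := normr_ge0 (a - b); nra.
Unshelve. all: by end_near. Qed.

(** The continuous [N] attains a positive minimum on the compact unit sphere of the sup norm;
    homogeneity does the rest. *)
Lemma is_norm_ge : exists2 M : R, 0 < M & forall a, `|a| <= M * N a.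
Proof.
case: N_norm => ND NZ Neq0.
pose S := [set a : 'rV[R]_n | `|a| = 1].
have normalize a : a != 0 -> S (`|a|^-1 *: a).
  by move=> a0; rewrite /S /= normrZ normfV normr_id mulVf// normr_eq0.
(* An empty sphere means that 0 is the only vector, as for [n = 0]; any positive constant then
   works. *)
have [/eqP S0|/set0P S0] := eqVneq S set0.
  exists 1 => // a; have [->|/normalize] := eqVneq a 0.
    by rewrite normr0 mul1r is_norm_ge0.
  by move/eqP : S0 => ->.
have cS : compact S.
  apply: bounded_closed_compact.
    by apply: (@bounded_set_normle _ _ _ 1) => a ->.
  have -> : S = (fun a : 'rV[R]_n => `|a|) @^-1` [set 1] by [].
  apply: (continuous_closedP _).1; first exact: norm_continuous.
  exact: closed_eq.
have [m] := EVT_min_rV S0 cS (continuous_subspaceT is_norm_continuous).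
rewrite inE => m1 Nm.
have Nm0 : 0 < N m.
  rewrite lt_neqAle is_norm_ge0 andbT eq_sym; apply/eqP => /Neq0 m0.
  by move: m1; rewrite /S /= m0 normr0 => /esym/eqP; rewrite oner_eq0.
exists (N m)^-1 => [|a]; first by rewrite invr_gt0.
have [->|a0] := eqVneq a 0; first by rewrite normr0 is_norm0 mulr0.
have /mem_set/Nm := normalize _ a0.
rewrite NZ normfV normr_id mulrC ler_pdivlMr ?normr_gt0// => h.
by rewrite mulrC ler_pdivlMr// mulrC.
Qed.

Lemma dual_norm_rV_has_sup u : has_sup [set dot a u | a in [set a | N a <= 1]].
Proof.
have [M M0 NM] := is_norm_ge; split.
  by exists (dot 0 u), 0 => //=; rewrite is_norm0.
exists (\sum_i M * `|u 0 i|) => _ [a /= Na <-]; apply: ler_sum => i _.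
apply: le_trans (ler_norm _) _; rewrite normrM ler_wpM2r//.
apply: le_trans (coord_le_norm _ _) _; apply: le_trans (NM a) _.
by rewrite -[leRHS]mulr1 ler_pM2l.
Qed.

Lemma dot_le_dual_norm a u t : N a <= t -> dot a u <= t * dual_norm_rV N u.
Proof.
move=> Nat; have t0 := le_trans (is_norm_ge0 a) Nat; case: N_norm => _ NZ Neq0.
have ub v : N v <= 1 -> dot v u <= dual_norm_rV N u.
  by move=> Nv; apply: (sup_upper_bound (dual_norm_rV_has_sup u)); exists v.
(* Rescaling by [t^-1] needs [t] nonzero; for [t = 0] the vector [a] is zero. *)
have [t_eq0|tn0] := eqVneq t 0.
  have -> : a = 0.
    by apply: Neq0; apply/eqP; rewrite eq_le is_norm_ge0 andbT -t_eq0.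
  by rewrite t_eq0 mul0r -(scale0r 0) dotZl mul0r.
have {tn0 t0} t0 : 0 < t by rewrite lt_neqAle eq_sym tn0.
have /ub : N (t^-1 *: a) <= 1.
  by rewrite NZ gtr0_norm ?invr_gt0// ler_pdivrMl// mulr1.
by rewrite dotZl ler_pdivrMl.
Qed.

Lemma dual_norm_rV_le u t : (forall a, N a <= 1 -> dot a u <= t) ->
  dual_norm_rV N u <= t.
Proof.
move=> h; apply: ge_sup; first by case: (dual_norm_rV_has_sup u).
by move=> _ [a /= Na <-]; exact: h.
Qed.

Lemma dual_norm_rV_triangle u v :
  dual_norm_rV N u <= dual_norm_rV N (u - v) + dual_norm_rV N v.
Proof.
apply: dual_norm_rV_le => a Na; rewrite -{1}(subrK v u) dotDr.
rewrite -[dual_norm_rV N _ in leRHS]mul1r -[dual_norm_rV N v in leRHS]mul1r.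
by rewrite lerD ?dot_le_dual_norm.
Qed.

End NormRowVectors.

(** * Weak neighbourhoods and uniform avoidance of a weakly closed set *)

Section WeakTopology.
Context {R : realType} {B Y : lmodType R}.
Variable g : {bilinear B -> Y -> R | *%R & *%R}.

(** A base indexed by finitely many functionals and one radius, so that these data can be extracted
    from a member of the filter. *)
Definition weak_nbhs0 : set_system B :=
  filter_from [set p : seq Y * R | 0 < p.2]
    (fun p => [set z | forall y, y \in p.1 -> `|g z y| < p.2]).

#[local] Instance weak_nbhs0_filter : Filter weak_nbhs0.
Proof.
apply: filter_from_filter; first by exists ([::], 1) => /=.
move=> [s d] [t e] /= d0 e0; exists (s ++ t, Num.min d e) => /=.
  by rewrite lt_min d0.
move=> z h; split => y ys; have := h y; rewrite mem_cat ys ?orbT => /(_ isT);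
  by rewrite lt_min => /andP[].
Qed.

Lemma cvg_weak_nbhs0 y : g z y @[z --> weak_nbhs0] --> (0 : R).
Proof.
apply/cvgrPdist_lt => e e0; exists ([:: y], e) => //= z h.
by rewrite sub0r normrN h// mem_seq1.
Qed.

Lemma cvg_weak_of_pair {T : Type} {F : set_system T} {FF : Filter F}
    (h : T -> B) (l : B) :
  (forall y, g (h t) y @[t --> F] --> g l y) ->
  (h t : weak_of_pair g) @[t --> F] --> (l : weak_of_pair g).
Proof.
move=> hl; apply/cvg_sup => y U /= [_ [[V oV <-] Vl VU]].
have /hl FV : nbhs (g l y) V by apply: open_nbhs_nbhs.
by apply: (@filterS _ F FF _ _ _ FV) => t Vt; exact: VU.
Qed.

(* Compactness makes the weak neighbourhood separating [h a] from [K] uniform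
   in [a]. *)
Lemma compact_avoid_weak_closed {T : topologicalType} (Q : set T) (h : T -> B)
    (K : set B) :
  compact Q -> @closed (weak_of_pair g) K ->
  (forall y, continuous (fun a => g (h a) y)) ->
  (forall a, Q a -> ~ K (h a)) ->
  exists s : seq Y, exists2 e : R, 0 < e &
    forall a k, Q a -> K k -> exists2 y, y \in s & e <= `|g (h a - k) y|.
Proof.
move=> cQ cK ch QK.
have /(_ B weak_nbhs0 (fun z a => ~ K (h a - z)) _) :=
  (compact_near_coveringP Q).1 cQ.
case=> [a Qa|[s e] /= e0 sub].
  (* Joint weak continuity at [(a, 0)] of [(a, z) |-> h a - z]; the complement of [K] is a weak
     neighbourhood of [h a]. *)
  have cvg : (h x.1 - x.2 : weak_of_pair g)
      @[x --> filter_prod (nbhs a) weak_nbhs0] --> (h a : weak_of_pair g).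
    apply: cvg_weak_of_pair => y.
    rewrite -[g (h a) y]subr0; under eq_fun do rewrite linearBl.
    apply: (@cvgB _ _ _ _ _ (fun x => g (h x.1) y) (fun x => g x.2 y)).
      exact: (@cvg_comp _ _ _ fst (fun x => g (h x) y) _ _ _ cvg_fst (ch y a)).
    exact: (@cvg_comp _ _ _ snd (g ^~ y) _ _ _ cvg_snd (@cvg_weak_nbhs0 y)).
  apply: (cvg (~` K)); apply: open_nbhs_nbhs; split; last exact: QK.
  by rewrite openC.
exists s, e => // a k Qa Kk; apply: contrapT => no.
(* For [z = h a - k] the point [h a - z] is [k], which lies in [K]. *)
apply: (sub (h a - k) _ a Qa); last by rewrite subKr.
move=> y ys; rewrite ltNge; apply/negP => le; apply: no.
by exists y.
Qed.

End WeakTopology.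

(** * Auxiliary facts on affine functions and convex cones *)

Lemma ge0_of_affine_bounded_below {R : realType} (d C D : R) :
  (forall t, 0 <= t -> d <= C + t * D) -> 0 <= D.
Proof.
move=> h; rewrite leNgt; apply/negP => D0.
(* At this [t] the affine function equals [C - |C - d| - 1], which is below [d]. *)
have /h : 0 <= (`|C - d| + 1) / - D.
  by rewrite divr_ge0 ?addr_ge0// oppr_ge0 ltW.
rewrite invrN mulrN mulNr divfK ?lt_eqF// => H.
have := ler_norm (C - d); lra.
Qed.

(** The sum is twice the midpoint, which convexity keeps in [K]. *)
Lemma coneD {R : realType} {B : lmodType R} {K : set B} :
  convex_set (K : set (convex_lmodType B)) -> cone K ->
  forall z w, K z -> K w -> K (z + w).
Proof.
move=> Kcvx Kcone z w Kz Kw.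
have h0 : 0 <= 2^-1 :> R by lra.
have h1 : 2^-1 <= 1 :> R by lra.
have e1 : 2 * 2^-1 = 1 :> R by lra.
have e2 : 2 * (1 - 2^-1) = 1 :> R by lra.
have -> : z + w = 2 *: (2^-1 *: z + (1 - 2^-1) *: w).
  by rewrite scalerDr !scalerA e1 e2 !scale1r.
apply: Kcone; first exact: ler0n.
exact/set_mem/(Kcvx z w (Itv01 h0 h1) (mem_set Kz) (mem_set Kw)).
Qed.

(** * Weak and strong duality of the two programs *)

Section Duality.
Context {R : realType} {X : normedModType R} {C : lmodType R}.
Variable f : {bilinear X -> C -> R | *%R & *%R}.
Context {B : normedModType R} {Y : lmodType R}.
Variable g : {bilinear B -> Y -> R | *%R & *%R}.
Variables (A : {linear X -> B}) (K : set B) (c : C) (b : B).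
Context {n : nat}.
Variables (x : 'I_n -> X) (N : 'rV[R]_n -> R) (thetaP : R).
Hypothesis N_norm : is_norm N.
Hypothesis thetaP_gt0 : 0 < thetaP.

Local Notation An := (An A x).
Local Notation cvec := (cvec f c x).
Local Notation feas := (primal_feasible A K b x N thetaP).
Local Notation J := (primal_value f A K c b x N thetaP).
Local Notation J' := (dual_value f g A K c b x N thetaP).
Local Notation obj := (dual_objective f g A c b x N thetaP).

Lemma pairing_An a y : g (An a) y = dot a (An_adj g A x y).
Proof.
rewrite linear_sumlz; apply: eq_bigr => i _.
by rewrite linearZl_LR mxE.
Qed.

Lemma An_linear (s t : R) a a' : An (s *: a + t *: a') = s *: An a + t *: An a'.
Proof.
rewrite !scaler_sumr -big_split; apply: eq_bigr => i _ /=.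
by rewrite !mxE scalerDl !scalerA.
Qed.

(** Pairing [An a - b] with [y] bounds [g b y] by [dot a (An_adj y)], and the penalty term absorbs
    [dot a (An_adj y - cvec)]. *)
Lemma dual_objective_le_primal a y :
  feas a -> dual_cone g K y -> obj y <= dot a cvec.
Proof.
move=> [KA Na] /(_ _ KA); rewrite linearBl pairing_An => h.
have := dot_le_dual_norm N_norm a (An_adj g A x y - cvec) thetaP Na.
by rewrite dotBr /dual_objective => ?; lra.
Qed.

Lemma primal_value_ge : ((- (thetaP * dual_norm_rV N cvec))%:E <= J)%E.
Proof.
apply: le_ereal_inf_tmp => _ [a [_ Na] <-]; rewrite lee_fin.
have := dot_le_dual_norm N_norm (- a) cvec thetaP.
by rewrite (is_normN N_norm) dotNl => /(_ Na) ?; lra.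
Qed.

Hypothesis K_closed : @closed (weak_of_pair g) K.
Hypothesis K_convex : convex_set (K : set (convex_lmodType B)).
Hypothesis K_cone : cone K.
Hypothesis feasible : feas !=set0.

Lemma weak_duality : (J' <= J)%E.
Proof.
apply: ge_ereal_sup => _ [y Ky <-]; apply: le_ereal_inf_tmp => _ [a Fa <-].
by rewrite lee_fin; exact: dual_objective_le_primal.
Qed.

(* Separates the origin from the convex set of all
   [(An a - b - k, dot a cvec - r + t)] with [N a <= thetaP], [K k] and
   [0 <= t], seen through finitely many functionals of [Y]. *)
Lemma strong_separation (r r' : R) : r < r' ->
  (forall a, feas a -> r' < dot a cvec) ->
  exists l0 : R, exists y0 : Y, exists2 d : R, 0 < d &
    forall a k t, N a <= thetaP -> K k -> 0 <= t ->
      d <= l0 * (dot a cvec - r + t) + g (An a - b - k) y0.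
Proof.
move=> rr' r'J; case: (N_norm) => ND NZ _; have [a0 [Ka0 Na0]] := feasible.
(* Feasible points have objective above [r'], so [An a - b] avoids [K] on all of [Q]. *)
pose Q := [set a | N a <= thetaP] `&` [set a | dot a cvec <= r'].
have cQ : compact Q.
  apply: bounded_closed_compact.
    have [M M0 NM] := is_norm_ge N_norm.
    apply: (@bounded_set_normle _ _ _ (M * thetaP)) => a [/= Na _].
    by apply: le_trans (NM a) _; rewrite ler_pM2l.
  apply: closedI; apply: closed_fun_le; first exact: is_norm_continuous.
  by move=> a; apply: (@cvg_dot _ _ _ (nbhs a) _ id (fun=> cvec)) => //;
    exact: cvg_cst.
have [||s [e e0 avoid]] :=
    @compact_avoid_weak_closed _ _ _ g _ Q (fun a => An a - b) K cQ K_closed.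
- move=> y a; under eq_fun do rewrite linearBl pairing_An.
  apply: (@cvgB _ _ _ (nbhs a) _ (fun a' => dot a' (An_adj g A x y)));
    last exact: cvg_cst.
  by apply: (@cvg_dot _ _ _ (nbhs a) _ id (fun=> An_adj g A x y)) => //;
    exact: cvg_cst.
- by move=> a [Na ar'] Ka; have := r'J a (conj Ka Na); rewrite ltNge ar'.
pose ys (j : 'I_(size s)) := nth 0 s j.
(* Coordinate [ord0] carries the scalar [v]; the others carry the functionals of [s] at [z]. *)
pose Phi (z : B) (v : R) : 'rV[R]_(size s).+1 :=
  \row_i oapp (fun j => g z (ys j)) v (unlift ord0 i).
pose T := [set p | exists a k t, [/\ N a <= thetaP, K k, 0 <= t &
   p = Phi (An a - b - k) (dot a cvec - r + t)]].
(* On [Q] some functional of [s] is at least [e] in absolute value; off [Q] the scalar coordinate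
   exceeds [r' - r]. *)
have [||||l [d d0 ld]] := @convex_separation_rV _ _ T (Num.min e (r' - r)).
- exists (Phi (An a0 - b - (An a0 - b)) (dot a0 cvec - r + 0)).
  by exists a0, (An a0 - b), 0; split.
- move=> _ _ u /andP[u0 u1] [a [k [t [Na Kk t0 ->]]]]
    [a' [k' [t' [Na' Kk' t0' ->]]]].
  have v0 : 0 <= 1 - u by lra.
  exists ((1 - u) *: a + u *: a'), ((1 - u) *: k + u *: k'),
    ((1 - u) * t + u * t'); split.
  + apply: le_trans (ND _ _) _; rewrite !NZ !ger0_norm//.
    by have := is_norm_ge0 N_norm a; nra.
  + by apply: (coneD K_convex K_cone); exact: K_cone.
  + by rewrite addr_ge0// mulr_ge0.
  + apply/rowP => i; rewrite !mxE An_linear; case: (unlift ord0 i) => [j|] /=.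
      by rewrite !(linearBl, linearDl, linearZl_LR) /=; ring.
    by rewrite !(dotDl, dotZl); ring.
- by rewrite lt_min e0 subr_gt0.
- move=> p [a [k [t [Na Kk t0 ->]]]]; rewrite ge_min.
  have [//|r'a] := leP e; have [ar'|r'a'] := leP (dot a cvec) r'.
    have [y ys_y ey] := avoid a k (conj Na ar') Kk; exfalso.
    have yl : (index y s < size s)%N by rewrite index_mem.
    have := coord_le_norm (Phi (An a - b - k) (dot a cvec - r + t))
      (lift ord0 (Ordinal yl)).
    rewrite mxE liftK /= /ys /= nth_index// leNgt => /negP; apply.
    exact: lt_le_trans r'a ey.
  apply: le_trans (coord_le_norm _ ord0); rewrite mxE unlift_none /=.
  by rewrite (le_trans _ (ler_norm _))//; lra.
(* By linearity the weighted functionals collapse to a single element of [Y]. *)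
exists (l 0 ord0), (\sum_j l 0 (lift ord0 j) *: ys j), d => // a k t Na Kk t0.
have /ld : T (Phi (An a - b - k) (dot a cvec - r + t)) by exists a, k, t.
rewrite /dot big_ord_recl mxE unlift_none /= linear_sumr.
congr (_ <= _ + _); apply: eq_bigr => j _.
by rewrite mxE liftK /= linearZr_LR.
Qed.

Lemma dual_objective_ge (r r' : R) : r < r' ->
  (forall a, feas a -> r' < dot a cvec) ->
  exists2 y, dual_cone g K y & r <= obj y.
Proof.
move=> rr' r'J; have [l0 [y0 [d d0 sep]]] := strong_separation _ _ rr' r'J.
have [a0 [Ka0 Na0]] := feasible.
have K0 : K 0 by rewrite -(scale0r (An a0 - b)); exact: K_cone.
(* Let [t] grow in [sep]; below, for [y0K], let the multiple [t *: k] grow. *)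
have l0_ge0 : 0 <= l0.
  apply: (@ge0_of_affine_bounded_below _ d
    (l0 * (dot a0 cvec - r) + g (An a0 - b - 0) y0)) => t t0.
  by have := sep a0 0 t Na0 K0 t0; lra.
have y0K k : K k -> 0 <= - g k y0.
  move=> Kk; apply: (@ge0_of_affine_bounded_below _ d
    (l0 * (dot a0 cvec - r) + g (An a0 - b) y0)) => t t0.
  have := sep a0 (t *: k) 0 Na0 (K_cone _ _ t0 Kk) (lexx 0).
  by rewrite linearBl linearZl_LR /=; lra.
(* With [l0 = 0], the choice [k = An a0 - b] would give [d <= 0]: feasibility of [a0] enters
   here. *)
have l0_gt0 : 0 < l0.
  rewrite lt_neqAle l0_ge0 andbT eq_sym; apply/eqP => l00.
  have := sep a0 _ 0 Na0 Ka0 (lexx 0).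
  by rewrite l00 subrr mul0r linear0l; lra.
exists (- l0^-1 *: y0) => [z Kz|].
  by rewrite linearZr_LR /= mulNr -mulrN mulr_ge0 ?invr_ge0//; exact: y0K.
set y := - l0^-1 *: y0.
suff : dual_norm_rV N (An_adj g A x y - cvec) <= (g b y - r) / thetaP.
  by rewrite ler_pdivlMr// /dual_objective; lra.
apply: dual_norm_rV_le => // a Na; rewrite ler_pdivlMr// mulrC -dotZl.
have {}Na : N (thetaP *: a) <= thetaP.
  by case: N_norm => _ NZ _; rewrite NZ gtr0_norm// -[leRHS]mulr1 ler_pM2l.
move: (thetaP *: a) Na => {}a Na.
have := sep a 0 0 Na K0 (lexx 0); rewrite subr0 addr0 => h.
(* The subtracted term is the right-hand side of [sep] at [k = 0], [t = 0], divided by [l0], hence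
   nonnegative. *)
have -> : dot a (An_adj g A x y - cvec) =
    g b y - r - l0^-1 * (l0 * (dot a cvec - r) + g (An a - b) y0).
  rewrite dotBr -pairing_An /y !linearZr_LR /= linearBl mulrDr mulKf ?gt_eqF//.
  by ring.
by rewrite gerBl mulr_ge0 ?invr_ge0// ltW// (lt_le_trans d0).
Qed.

Lemma strong_duality : J = J'.
Proof.
apply/eqP; rewrite eq_le weak_duality andbT.
have [a0 Fa0] := feasible.
have lbJ a : feas a -> (J <= (dot a cvec)%:E)%E.
  by move=> Fa; apply: ereal_inf_lbound; exists a.
(* The value [-oo] makes the inequality trivial, and [a0] excludes [+oo]. *)
case EJ : J lbJ => [j| |] lbJ; last by rewrite leNye.
  2: by have := lbJ _ Fa0; rewrite leNgt ltry.
apply/lee_subgt0Pr => e e0.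
(* The midpoint [j - e / 2] leaves strict room on both sides. *)
have [||y Ky yj] := @dual_objective_ge (j - e) (j - e / 2).
- by lra.
- by move=> a /lbJ; rewrite lee_fin; lra.
rewrite -EFinB; apply: le_trans (_ : ((obj y)%:E <= _)%E).
  by rewrite lee_fin.
by apply: ereal_sup_ubound; exists y.
Qed.

End Duality.

(** * Dual norm estimates and the bound on dual optimizers *)

Lemma pairing_le_dual_norm {R : realType} {B : normedModType R} {Y : lmodType R}
    (g : {bilinear B -> Y -> R | *%R & *%R}) (b : B) (y : Y) (D : R) :
  dual_norm g y = D%:E -> g b y <= `|b| * D.
Proof.
move=> gD; have [->|b0] := eqVneq b 0; first by rewrite linear0l normr0 mul0r.
have nb0 : 0 < `|b| by rewrite normr_gt0.
rewrite -ler_pdivrMl// -(linearZl_LR g) -lee_fin -gD.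
apply: ereal_sup_ubound; exists (`|b|^-1 *: b) => //=.
by rewrite normrZ normfV normr_id mulVf ?gt_eqF.
Qed.

(** The upper bound excludes [+oo] and the origin of the unit ball excludes [-oo], so later
    estimates can be made in [R]. *)
Lemma dual_norm_fin {R : realType} {B : normedModType R} {Y : lmodType R}
    (g : {bilinear B -> Y -> R | *%R & *%R}) (y : Y) (gamma M : R) :
  0 < gamma -> (gamma%:E * dual_norm g y <= M%:E)%E ->
  exists2 D : R, dual_norm g y = D%:E & gamma * D <= M.
Proof.
move=> gamma0.
have : (0 <= dual_norm g y)%E.
  apply: ereal_sup_ubound; exists 0; first by rewrite /= normr0.
  by rewrite linear0l.
case: (dual_norm g y) => [D _|_|//].
  by rewrite -EFinM lee_fin => ?; exists D.
by rewrite gt0_muley ?lte_fin// leye_eq.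
Qed.

Theorem proposition3p2 (R : realType)
    (X : normedModType R) (C : lmodType R)
    (f : {bilinear X -> C -> R | *%R & *%R}) (f_sep : separating f)
    (B : normedModType R) (Y : lmodType R)
    (g : {bilinear B -> Y -> R | *%R & *%R}) (g_sep : separating g)
    (A : {linear X -> B})
    (A_cont : continuous (A : weak_of_pair f -> weak_of_pair g))
    (K : set B)
    (K_closed : @closed (weak_of_pair g) K)
    (K_convex : convex_set (K : set (convex_lmodType B)))
    (K_cone : cone K)
    (c : C) (b : B)
    (n : nat) (x : 'I_n -> X)
    (x_free : lin_indep x) (x_unit : forall i, `|x i| = 1)
    (N : 'rV[R]_n -> R) (N_norm : is_norm N)
    (thetaP : R) (thetaP_gt0 : 0 < thetaP)
    (feasible : primal_feasible A K b x N thetaP !=set0) :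
  primal_value f A K c b x N thetaP = dual_value f g A K c b x N thetaP
  /\
  (forall gamma : R, 0 < gamma ->
    (forall y, dual_cone g K y ->
      (gamma%:E * dual_norm g y <= (dual_norm_rV N (An_adj g A x y))%:E)%E) ->
    `|b| < gamma * thetaP ->
    forall (y : Y) (JLB : R),
      dual_optimizer f g A K c b x N thetaP y ->
      (JLB%:E <= primal_value f A K c b x N thetaP)%E ->
      [/\ (dual_norm g y <= (thetaD f c b x N thetaP gamma JLB)%:E)%E,
          - (thetaP * dual_norm_rV N (cvec f c x)) <= JLB ->
            thetaD f c b x N thetaP gamma JLB <=
            2 * thetaP * dual_norm_rV N (cvec f c x)
              / (gamma * thetaP - `|b|)
        & (dual_norm g y <=
            (2 * thetaP * dual_norm_rV N (cvec f c x)
              / (gamma * thetaP - `|b|))%:E)%E]).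
Proof.
have zero_gap : primal_value f A K c b x N thetaP =
    dual_value f g A K c b x N thetaP by exact: strong_duality.
split=> // gamma gamma0 ge_gamma b_lt y JLB [Ky opt] JLB_le.
have den0 : 0 < gamma * thetaP - `|b| by rewrite subr_gt0.
have [D gD DM] := dual_norm_fin _ _ _ _ gamma0 (ge_gamma y Ky).
(* Kept general in [J]: it serves for [JLB] and for the trivial bound of [primal_value_ge], which
   produces the factor 2. *)
have bound J : (J%:E <= primal_value f A K c b x N thetaP)%E ->
    (dual_norm g y <= (thetaD f c b x N thetaP gamma J)%:E)%E.
  rewrite zero_gap -opt lee_fin /dual_objective => J_le.
  rewrite gD lee_fin /thetaD ler_pdivlMr//.
  have gbD := pairing_le_dual_norm g b y D gD.
  have tri := dual_norm_rV_triangle N_norm (An_adj g A x y) (cvec f c x).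
  have : thetaP * (gamma * D) <= thetaP * (dual_norm_rV N (An_adj g A x y -
      cvec f c x) + dual_norm_rV N (cvec f c x)).
    by rewrite ler_pM2l// (le_trans DM).
  by lra.
have twice : thetaD f c b x N thetaP gamma
    (- (thetaP * dual_norm_rV N (cvec f c x))) =
  2 * thetaP * dual_norm_rV N (cvec f c x) / (gamma * thetaP - `|b|).
  by rewrite /thetaD; congr (_ / _); ring.
split; first exact: bound.
  by move=> JLB_ge; rewrite -twice /thetaD ler_pM2r ?invr_gt0// lerD2l lerN2.
by rewrite -twice; apply: bound; exact: primal_value_ge.
Qed.
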